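(* Let $\{P^{[n]}\}_{n\in\mathbb{N}}$ be a sequence of equal-neighbor matrices of increasing dimensions ($P^{[n]}\in\mathbb{R}^{n\times n}$). The following are equivalent: (i) there is no $P^{[n]}$-prominent individual; (ii) the sequence is one-time wise; (iii) the sequence is pre-uniformly wise.
   Context: An $n\times n$ matrix $P$ is equal-neighbor if $P=\mathrm{diag}(W\mathbf{1}_n)^{-1}W$ for some symmetric matrix $W\in\{0,1\}^{n\times n}$ with at least one nonzero entry in each row (diagonal entries allowed); equivalently $P_{ij}=1/d_i$ if $W_{ij}=1$ and $0$ otherwise, where $d_i=\sum_jW_{ij}$. $\|P\|_1=\max_j\sum_iP_{ij}$. A $P^{[n]}$-prominent individual is a sequence of nodes $k^{[n]}\in\{1,\dots,n\}$ whose total one-time influence $\frac1n\sum_{i=1}^nP^{[n]}_{ik^{[n]}}$ is of order $1$; ''there is no $P^{[n]}$-prominent individual'' means: for every sequence $k^{[n]}\in\{1,\dots,n\}$, $\frac1n\sum_{i=1}^nP^{[n]}_{ik^{[n]}}\to0$ as $n\to\infty$. One-time wisdom: for each $n$, $x^{[n]}_i(0)=\mu+\xi^{[n]}_i(0)$ with $\mu\in\mathbb{R}$ fixed and $\xi^{[n]}_i(0)$ independent Gaussian with mean $0$ and common variance $\sigma^2\in(0,\infty)$, $x^{[n]}(1)=P^{[n]}x^{[n]}(0)$; the sequence is one-time wise if $\frac1n\sum_ix^{[n]}_i(1)\to\mu$ in probability. The sequence is pre-uniformly wise if $\lim_{n\to\infty}\sup_{k\in\mathbb{N}}\|\tfrac1n(P^{[n]})^k\|_1=0$.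 *)

(* Defs.v *)
From HB Require Import structures.
From mathcomp Require Import all_boot all_order all_algebra.
From mathcomp Require Import all_classical all_reals all_analysis.
Set Implicit Arguments. Unset Strict Implicit. Unset Printing Implicit Defensive.
Import Order.TTheory GRing.Theory Num.Theory.
Import numFieldNormedType.Exports.
Local Open Scope classical_set_scope.
Local Open Scope ring_scope.

(* Convention: the sequence index n : nat stands for the paper's dimension n+1,
   i.e. P n : 'M_n.+1 is the paper's P^{[n+1]}. *)

Definition equal_neighbor (R : realType) (m : nat) (P : 'M[R]_m) : Prop :=
  exists W : 'M[R]_m,
    [/\ W^T = W,
        (forall i j, W i j = 0 \/ W i j = 1),
        (forall i, exists j, W i j != 0) &
        P = invmx (diag_mx (\row_i (\sum_j W i j))) *m W].

Definition norm1 (R : realType) (m : nat) (A : 'M[R]_m) : R :=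
  \big[Num.max/0]_(j < m) \sum_(i < m) `|A i j|.

Definition influence (R : realType) (m : nat) (P : 'M[R]_m.+1) (k : 'I_m.+1) : R :=
  (m.+1)%:R^-1 * \sum_(i < m.+1) P i k.

Definition no_prominent (R : realType) (P : forall n, 'M[R]_n.+1) : Prop :=
  forall k : forall n, 'I_n.+1,
    (fun n => influence (P n) (k n)) @ \oo --> (0 : R).

Definition mutually_independent (R : realType) (d : measure_display)
    (T : measurableType d) (Pr : probability T R) (m : nat)
    (X : 'I_m -> {RV Pr >-> R}) : Prop :=
  forall B : 'I_m -> set R, (forall i, measurable (B i)) ->
    Pr (\bigcap_(i in [set: 'I_m]) (X i @^-1` B i)) =
    (\prod_(i < m) Pr (X i @^-1` B i))%E.

(* X is Gaussian with mean 0 and variance sigma^2 (standard deviation sigma) *)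
Definition gaussian0 (R : realType) (d : measure_display)
    (T : measurableType d) (Pr : probability T R) (sigma : R)
    (X : {RV Pr >-> R}) : Prop :=
  forall A : set R, measurable A -> distribution Pr X A = normal_prob 0 sigma A.

Definition one_time_wise (R : realType) (mu sigma : R)
    (P : forall n, 'M[R]_n.+1) : Prop :=
  forall (d : nat -> measure_display) (T : forall n, measurableType (d n))
         (Pr : forall n, probability (T n) R)
         (xi : forall n, 'I_n.+1 -> {RV Pr n >-> R}),
    (forall n, mutually_independent (xi n)) ->
    (forall n i, gaussian0 sigma (xi n i)) ->
    let x1 n t i := \sum_(j < n.+1) P n i j * (mu + xi n j t) in
    forall eps : R, 0 < eps ->
      (fun n => Pr n [set t | eps <= `| (n.+1)%:R^-1 * \sum_(i < n.+1) x1 n t i - mu |])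
        @ \oo --> 0%E.

Definition pre_uniformly_wise (R : realType) (P : forall n, 'M[R]_n.+1) : Prop :=
  (fun n => sup (range (fun k : nat => norm1 ((n.+1)%:R^-1 *: (P n ^+ k)))))
    @ \oo --> (0 : R).

(* Main.v *)
(* (i) <-> (iii): let [v_k j] be the [j]-th column sum of [P ^ k] and [d] the
   degrees. Since [P] is reversible with respect to [d], [v_k <= d], hence
   [v_k i / d i <= t * v_k i + 1 / (t * d i)] for all [t > 0]; summing over the
   neighbours [i] of [j] gives [v_(k+1) j <= t * n + v_1 j / t], uniformly in [k].
   (i) -> (ii): the error of the mean opinion is [\sum_j a_j xi_j], where the
   influences [a_j] sum to 1, and its variance is at most a constant times
   [max_j a_j] (Chebyshev).
   (ii) -> (i): on a space with independent Gaussians, flipping the sign of every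
   noise except that of [k] gives another admissible noise; the two errors add up
   to [2 a_k xi_k], which therefore tends to 0 in probability. *)
Require Import Defs.
From HB Require Import structures.
From mathcomp Require Import all_boot all_order all_algebra.
From mathcomp Require Import all_classical all_reals all_analysis.
(* [all_analysis] does not export the measurable structure of [\bar R]. *)
From mathcomp Require Import measurable_realfun.
From mathcomp Require Import ring lra.
Set Implicit Arguments. Unset Strict Implicit. Unset Printing Implicit Defensive.
Import Order.TTheory GRing.Theory Num.Theory.
Import numFieldNormedType.Exports.
Local Open Scope classical_set_scope.
Local Open Scope ring_scope.

(** The inverse of the degree matrix becomes an entrywise division; the degrees are at least 1
    because every row of [W] contains an entry 1. *)
Lemma equal_neighborP (R : realType) (m : nat) (P : 'M[R]_m) :
  equal_neighbor P ->
  exists (W : 'M[R]_m) (d : 'I_m -> R),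
    [/\ forall i j, W i j = W j i, forall i j, 0 <= W i j <= 1,
        forall i, d i = \sum_j W i j, forall i, 1 <= d i &
        forall i j, P i j = W i j / d i].
Proof.
move=> [W [WT W01 Wn0 ->]]; exists W, (fun i => \sum_j W i j).
have W0 i j : 0 <= W i j by case: (W01 i j) => ->.
have d1 i : 1 <= \sum_j W i j.
  have [j Wij] := Wn0 i; rewrite (bigD1 j)//=.
  case: (W01 i j) Wij => ->; rewrite ?eqxx// => _.
  by rewrite lerDl sumr_ge0.
split => // [i j|i j|i j]; first by rewrite -[in LHS]WT mxE.
  by case: (W01 i j) => ->; rewrite lexx ler01.
set D := diag_mx _.
have DU : D \in unitmx.
  rewrite unitmxE det_diag unitfE prodf_seq_neq0; apply/allP => k _ /=.
  by rewrite mxE gt_eqF// (lt_le_trans ltr01).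
have : (D *m (invmx D *m W)) i j = W i j by rewrite mulKVmx.
rewrite mul_diag_mx !mxE => <-.
by rewrite mulrAC divff ?mul1r// gt_eqF// (lt_le_trans ltr01).
Qed.

(** * Column sums of the powers of an equal-neighbor matrix *)

Section column_sums.
Variables (R : realType) (m : nat) (P : 'M[R]_m.+1).
Hypothesis enP : equal_neighbor P.

Lemma equal_neighbor_ge0 i j : 0 <= P i j.
Proof.
have [W [d [_ W0 _ d1 ->]]] := equal_neighborP enP.
by case/andP: (W0 i j) => ? _; rewrite divr_ge0// (le_trans ler01).
Qed.

Lemma equal_neighbor_row1 i : \sum_j P i j = 1.
Proof.
have [W [d [_ _ dE d1 PE]]] := equal_neighborP enP.
under eq_bigr do rewrite PE.
by rewrite -mulr_suml -dE divff// gt_eqF// (lt_le_trans ltr01).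
Qed.

Definition colsum k j := \sum_i (P ^+ k) i j.

Lemma colsum0 j : colsum 0 j = 1.
Proof.
rewrite /colsum expr0 (bigD1 j)//= mxE eqxx big1 ?addr0// => i ij.
by rewrite mxE (negbTE ij).
Qed.

Lemma colsumS k j : colsum k.+1 j = \sum_i colsum k i * P i j.
Proof.
rewrite /colsum exprSr; under eq_bigr do rewrite mxE.
by rewrite exchange_big; apply: eq_bigr => i _; rewrite mulr_suml.
Qed.

Lemma expr_equal_neighbor_ge0 k i j : 0 <= (P ^+ k) i j.
Proof.
elim: k j => [|k IH] j; first by rewrite expr0 mxE ler0n.
by rewrite exprSr mxE sumr_ge0// => l _; rewrite mulr_ge0// equal_neighbor_ge0.
Qed.

Lemma colsum_ge0 k j : 0 <= colsum k j.
Proof. by rewrite sumr_ge0// => i _; rewrite expr_equal_neighbor_ge0. Qed.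

Lemma sum_colsum k : \sum_j colsum k j = m.+1%:R.
Proof.
elim: k => [|k IH].
  by under eq_bigr do rewrite colsum0; rewrite sumr_const card_ord.
under eq_bigr do rewrite colsumS.
rewrite exchange_big -[RHS]IH; apply: eq_bigr => i _.
by rewrite -mulr_sumr equal_neighbor_row1 mulr1.
Qed.

(* As [v / d <= 1], the summand [v / d] is at most [t v] when [1 <= t d], and less
   than [1 / (t d)] otherwise. *)
Lemma colsum_le (t : R) k j : 0 < t ->
  colsum k.+1 j <= t * m.+1%:R + colsum 1 j / t.
Proof.
move=> t0; have [W [d [WC W01 dE d1 PE]]] := equal_neighborP enP.
have d0 i : 0 < d i by rewrite (lt_le_trans ltr01).
(* Induction: if [colsum l i' <= d i'], then [colsum l i' * P i' i] is at most [W i' i], and by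
   symmetry these weights sum to [d i]. *)
have colsum_d l i : colsum l i <= d i.
  elim: l i => [|l IH] i; first by rewrite colsum0.
  rewrite colsumS dE; apply: ler_sum => i' _.
  have /andP[W0 _] := W01 i' i.
  by rewrite PE mulrCA WC ler_piMr// ?(WC i)// ler_pdivrMr// mul1r.
(* The factor [m.+1%:R] is rewritten as the sum of [colsum k], so that the inequality can be checked
   for each [i] separately. *)
rewrite colsumS -(sum_colsum k) mulr_sumr [colsum 1 j]colsumS mulr_suml -big_split/=.
apply: ler_sum => i _; rewrite colsum0 mul1r PE.
have /andP[W0 W1] := W01 i j; have v0 := colsum_ge0 k i.
have [tdi|tdi] := leP 1 (t * d i).
  apply: (@le_trans _ _ (t * colsum k i)); last first.
    by rewrite lerDl !divr_ge0// ltW.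
  rewrite mulrA ler_pdivrMr// mulrAC.
  by rewrite (@le_trans _ _ (colsum k i))// ?ler_piMr// ler_peMl.
apply: (@le_trans _ _ (W i j / d i / t)); last first.
  by rewrite lerDr mulr_ge0// ltW.
rewrite mulrCA -[leRHS]mulrA ler_wpM2l//.
rewrite (@le_trans _ _ 1)//; first by rewrite ler_pdivrMr// mul1r.
by rewrite -invfM invf_ge1 ?mulr_gt0// mulrC ltW.
Qed.

Lemma norm1_le (c : R) (k : nat) : 0 <= c ->
  (forall j, m.+1%:R^-1 * colsum k j <= c) ->
  norm1 (m.+1%:R^-1 *: (P ^+ k)) <= c.
Proof.
move=> c0 colc; apply/bigmax_leP; split=> // j _.
rewrite (le_trans _ (colc j))// mulr_sumr; apply: ler_sum => i _.
by rewrite !mxE ger0_norm// mulr_ge0// ?expr_equal_neighbor_ge0// invr_ge0 ler0n.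
Qed.

Lemma influenceE j : influence P j = m.+1%:R^-1 * colsum 1 j.
Proof. by []. Qed.

Lemma norm1_ge0 (A : 'M[R]_m.+1) : 0 <= norm1 A.
Proof. exact: bigmax_ge_id. Qed.

Lemma influence_ge0 j : 0 <= influence P j.
Proof. by rewrite influenceE mulr_ge0 ?colsum_ge0// invr_ge0 ler0n. Qed.

Lemma sum_influence : \sum_j influence P j = 1.
Proof.
under eq_bigr do rewrite influenceE.
by rewrite -mulr_sumr sum_colsum mulVf// pnatr_eq0.
Qed.

Lemma norm1_le1 (k : nat) : norm1 (m.+1%:R^-1 *: (P ^+ k)) <= 1.
Proof.
apply: norm1_le => // j; rewrite mulrC ler_pdivrMr ?ltr0n// mul1r -(sum_colsum k).
by rewrite (bigD1 j)//= lerDl sumr_ge0// => i _; exact: colsum_ge0.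
Qed.

Lemma influence_le_norm1 j : influence P j <= norm1 (m.+1%:R^-1 *: (P ^+ 1)).
Proof.
apply: le_trans (le_bigmax _ _ j); rewrite influenceE mulr_sumr ler_sum// => i _.
by rewrite mxE ler_norm.
Qed.

(** A bound uniform in [k]: the first term covers [P ^+ 0], whose column sums are 1, and [t + c / t]
    comes from [colsum_le] divided by the dimension. The parameter [t] stays free to be balanced
    against [c]. *)
Lemma norm1_exp_le (c t : R) (k : nat) : 0 < t ->
  (forall j, influence P j <= c) ->
  norm1 (m.+1%:R^-1 *: (P ^+ k)) <= m.+1%:R^-1 + t + c / t.
Proof.
move=> t0 Pc; have m0 : 0 < m.+1%:R :> R by rewrite ltr0n.
have c0 : 0 <= c / t.
  by rewrite divr_ge0 ?(le_trans (influence_ge0 ord0) (Pc ord0)) ?ltW.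
apply: norm1_le => [|j]; first by rewrite !addr_ge0 ?invr_ge0 ?(ltW m0) ?(ltW t0).
case: k => [|k]; first by rewrite colsum0 mulr1 -addrA lerDl addr_ge0 ?(ltW t0).
rewrite -addrA ler_wpDl ?invr_ge0 ?(ltW m0)//.
rewrite (@le_trans _ _ (t + influence P j / t))//; last first.
  by rewrite lerD2l ler_pM2r// invr_gt0.
rewrite influenceE -mulrA ler_pdivrMl// mulrDr mulVKf ?gt_eqF//.
by rewrite [m.+1%:R * t]mulrC colsum_le.
Qed.

End column_sums.

(** * Absence of prominent individuals and pre-uniform wisdom *)

Section uniform_wisdom.
Variables (R : realType) (P : forall n, 'M[R]_n.+1).
Hypothesis enP : forall n, equal_neighbor (P n).

(** Needed because [sup] is a least upper bound only for nonempty sets that are bounded above. *)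
Lemma has_sup_norm1 n :
  has_sup (range (fun k => norm1 ((n.+1)%:R^-1 *: (P n ^+ k)))).
Proof.
split; first by exists (norm1 ((n.+1)%:R^-1 *: (P n ^+ 0))), 0%N.
by exists 1 => _ [k _ <-]; exact: norm1_le1.
Qed.

Lemma pre_uniformly_wise_no_prominent : pre_uniformly_wise P -> no_prominent P.
Proof.
move=> wP k; apply: squeeze_cvgr (cvg_cst 0) wP; apply: nearW => n.
rewrite influence_ge0//=; apply: le_trans (influence_le_norm1 _ _) _.
by apply: ub_le_sup; [exact: (has_sup_norm1 n).2|exists 1%N].
Qed.

(** Among all sequences of nodes is the one that picks a most influential node for each [n], so the
    convergence is uniform over the nodes. *)
Lemma no_prominent_max : no_prominent P ->
  exists2 c : nat -> R, c @ \oo --> 0 & forall n j, influence (P n) j <= c n.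
Proof.
move=> npP; pose k n := [arg max_(j > ord0) influence (P n) j]%O.
exists (fun n => influence (P n) (k n)); first exact: npP.
by move=> n j; rewrite /k; case: arg_maxP => //= i _; apply.
Qed.

Lemma no_prominent_pre_uniformly_wise : no_prominent P -> pre_uniformly_wise P.
Proof.
move=> /no_prominent_max[c c0 Pc]; apply/cvgrPdist_le => /= e e0.
(* Each of the three terms of [norm1_exp_le] is to be at most [e / 3]; for [c n / t] this means
   [c n <= t * t]. *)
pose t := e / 3; have t0 : 0 < t by rewrite divr_gt0.
have tt0 : 0 < t * t by rewrite mulr_gt0.
near=> n.
have [hs0 hsu] := has_sup_norm1 n.
rewrite sub0r normrN ger0_norm; last first.
  rewrite (le_trans (norm1_ge0 ((n.+1)%:R^-1 *: (P n ^+ 0))))//.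
  by apply: ub_le_sup => //; exists 0%N.
apply: ge_sup => // _ [k _ <-].
apply: (le_trans (norm1_exp_le (enP n) k t0 (Pc n))).
have -> : e = t + t + t by rewrite /t; field.
rewrite lerD ?lerD2r//.
  near: n; have := @cvg_harmonic R => /cvgrPdist_le /(_ _ t0).
  by apply: filterS => n; rewrite /= sub0r normrN; apply: le_trans; exact: ler_norm.
rewrite ler_pdivrMr//; near: n; have /cvgrPdist_le /(_ _ tt0) := c0.
by apply: filterS => n; rewrite /= sub0r normrN; apply: le_trans; exact: ler_norm.
Unshelve. all: by end_near. Qed.

End uniform_wisdom.

Lemma measurable_norm_ge (R : realType) (d : measure_display)
    (T : measurableType d) (f : T -> R) (e : R) :
  measurable_fun [set: T] f -> measurable [set t | e <= `|f t|].
Proof.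
move=> mf; rewrite (_ : [set _ | _] = (Num.norm \o f) @^-1` `[e, +oo[); last first.
  by apply/seteqP; split => x /=; rewrite in_itv/= andbT.
by rewrite -[X in measurable X]setTI; apply: measurableT_comp.
Qed.

(** * Integration against the normal law; its symmetry, second moment and tail *)

Section normal_prob_facts.
Variable R : realType.
Implicit Types m s x : R.
Local Notation leb := (@lebesgue_measure R).

(** The density [normal_pdf] equals the Radon-Nikodym derivative almost everywhere, since both have
    the same integral over every measurable set. *)
Lemma ge0_integral_normal_prob m s (f : R -> \bar R) :
  measurable_fun [set: R] f -> (forall x, 0 <= f x)%E ->
  (\int[normal_prob m s]_x f x = \int[leb]_x (f x * (normal_pdf m s x)%:E))%E.
Proof.
move=> mf f0.
have dom := normal_prob_dominates m s.
rewrite -(Radon_Nikodym_SigmaFinite.change_of_variables dom)//.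
have intg := Radon_Nikodym_SigmaFinite.f_integrable dom.
have mpdf := measurable_int _ (integrable_normal_pdf m s).
apply: ae_eq_integral => //.
- by apply: emeasurable_funM => //; exact: measurable_int intg.
- exact: emeasurable_funM.
- apply: ae_eqe_mul2l; apply: integral_ae_eq => // E _ mE.
  by rewrite -Radon_Nikodym_SigmaFinite.f_integral.
Qed.

(** The density is even and Lebesgue measure is invariant under negation. *)
Lemma normal_prob0N s (A : set R) : s != 0 -> measurable A ->
  normal_prob 0 s (-%R @^-1` A) = normal_prob 0 s A.
Proof.
move=> s0 mA; have := @normal_pdf_ge0 R 0 s; have := @measurable_normal_pdf R 0 s.
have gN x : normal_pdf 0 s (- x) = normal_pdf 0 s x.
  by rewrite !normal_pdfE// /normal_fun !subr0 sqrrN.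
set g := normal_pdf 0 s in gN * => mg g0.
rewrite /normal_prob -/g.
transitivity (\int[leb]_(x in -%R @^-1` A) ((EFin \o g) \o -%R) x)%E.
  by apply: eq_integral => x _ /=; rewrite gN.
rewrite -(@ge0_integral_pushforward _ _ (measurableTypeR R) (measurableTypeR R) R
   -%R _ leb A (EFin \o g))//.
- by apply: eq_measure_integral => B mB _; exact: lebesgue_measureN.
- by apply/measurable_funTS/measurable_EFinP.
- by move=> x _; rewrite lee_fin g0.
Qed.

(** Comparison with the wider normal density of standard deviation [2 * s]: three quarters of the
    exponent absorb the factor [x ^+ 2]. *)
Lemma normal_prob_moment2_lty s : s != 0 ->
  (\int[normal_prob 0 s]_x (x ^+ 2)%:E < +oo)%E.
Proof.
move=> s0; have s20 : 2 * s != 0 by rewrite mulf_neq0.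
pose K : R := 8 * s ^+ 2 * normal_peak s / normal_peak (2 * s).
rewrite ge0_integral_normal_prob//=; last first.
- by move=> x; rewrite lee_fin sqr_ge0.
- by apply/measurable_EFinP; exact: measurable_funX.
apply: (@le_lt_trans _ _ (\int[leb]_x (K%:E * (normal_pdf 0 (2 * s) x)%:E))%E).
  apply: ge0_le_integral => //=.
  - by move=> x _; rewrite lee_fin mulr_ge0 ?sqr_ge0// normal_pdf_ge0.
  - apply/measurable_EFinP/measurable_funM; first exact: measurable_funX.
    exact: measurable_normal_pdf.
  - apply/measurable_EFinP/measurable_funM => //.
    exact: measurable_normal_pdf.
  move=> x _; rewrite lee_fin !normal_pdfE// /K.
  have p0 : normal_peak (2 * s) != 0 by rewrite gt_eqF// normal_peak_gt0.
  rewrite mulrCA [leRHS](_ : _ =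
    normal_peak s * (8 * s ^+ 2 * normal_fun 0 (2 * s) x)); last by field.
  rewrite ler_wpM2l ?normal_peak_ge0// /normal_fun !subr0.
  (* With [u := x^2 / (8 s^2)], the claim is [u e^(-4u) <= e^(-u)]. *)
  pose u := x ^+ 2 / (8 * s ^+ 2).
  have u0 : 0 <= u by rewrite /u mulr_ge0 ?sqr_ge0// invr_ge0 mulr_ge0 ?sqr_ge0.
  have -> : - x ^+ 2 / (s ^+ 2 *+ 2) = - u - 3 * u by rewrite /u; field.
  have -> : - x ^+ 2 / ((2 * s) ^+ 2 *+ 2) = - u by rewrite /u; field.
  rewrite (_ : x ^+ 2 = 8 * s ^+ 2 * u); last by rewrite /u; field.
  rewrite -(mulrA (8 * _)) ler_wpM2l ?(mulr_ge0 _ (sqr_ge0 _))//.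
  rewrite expRD mulrCA ler_piMr ?expR_ge0//.
  rewrite expRN ler_pdivrMr ?expR_gt0// mul1r (le_trans _ (expR_ge1Dx _))//.
  by lra.
rewrite integralZl//; last exact: integrable_normal_pdf.
by rewrite integral_normal_pdf mule1 ltry.
Qed.

(** On [[1, 2]] the density is at least its value at 2. This probability later serves as a threshold
    independent of [n]. *)
Lemma normal_prob_gt0 s : s != 0 ->
  (0 < normal_prob 0 s [set x | (1 <= `|x|)%R])%E.
Proof.
move=> s0; pose c := normal_pdf 0 s 2.
have c0 : 0 < c by rewrite /c normal_pdfE// mulr_gt0 ?normal_peak_gt0 ?expR_gt0.
have mpdf : measurable_fun (`[1, 2]%classic : set R) (fun x => (normal_pdf 0 s x)%:E).
  by apply: measurable_funTS; apply/measurable_EFinP; exact: measurable_normal_pdf.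
apply: (@lt_le_trans _ _ (normal_prob 0 s `[1, 2]%classic)); last first.
  apply: le_measure; rewrite ?inE//.
      exact: measurable_norm_ge (@measurable_id _ R setT).
  by move=> x /=; rewrite in_itv/= => /andP[x1 _]; rewrite (le_trans x1)// ler_norm.
apply: (@lt_le_trans _ _ (\int[leb]_(x in `[1%R, 2%R]) c%:E)%E).
  rewrite integral_cst//= lebesgue_measure_itv/= lte_fin ltr1n.
  by rewrite mule_gt0// ?lte_fin// -EFinB lte_fin subr_gt0 ltr1n.
apply: ge0_le_integral => //=.
- by move=> x _; rewrite lee_fin ltW.
move=> x /=; rewrite in_itv/= => /andP[x1 x2].
rewrite lee_fin /c normal_pdfE// ler_wpM2l ?normal_peak_ge0//.
rewrite /normal_fun !subr0 ler_expR ler_pM2r ?invr_gt0 ?pmulrn_lgt0 ?exprn_even_gt0//.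
by rewrite lerN2 ler_pXn2r// nnegrE//; exact: le_trans x1.
Qed.

End normal_prob_facts.

(* [normal_prob] lives on [measurableTypeR R], whose measurable sets are those
   of [R] but whose display differs; [gauss s] is the same measure on [R]. *)
Section gauss.
Variable R : realType.
Implicit Types s : R.

Definition to_real (x : measurableTypeR R) : R := x.

Lemma measurable_to_real : measurable_fun [set: measurableTypeR R] to_real.
Proof. by move=> _ A mA; rewrite setTI. Qed.

HB.instance Definition _ := isMeasurableFun.Build _ _ (measurableTypeR R) R
  to_real measurable_to_real.

Definition gauss s : probability R R :=
  distribution (normal_prob 0 s) to_real.

Lemma gauss_moment2_lty s : s != 0 -> (\int[gauss s]_x (x ^+ 2)%:E < +oo)%E.
Proof.
move=> s0; rewrite ge0_integral_distribution//; last first.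
- by move=> x; rewrite lee_fin sqr_ge0.
- by apply/measurable_EFinP; exact: measurable_funX.
exact: normal_prob_moment2_lty.
Qed.

End gauss.

(** * Sign changes, covariances and Chebyshev's inequality for Gaussian variables *)

Section gaussian_variables.
Context (R : realType) (d : measure_display) (T : measurableType d).
Variables (Pr : probability T R) (s : R).
Hypothesis s0 : s != 0.
Implicit Types X Y : {RV Pr >-> R}.

Definition flip_sign (b : bool) X : {RV Pr >-> R} :=
  if b then - (X : {mfun T >-> R}) else X.

Lemma flip_sign_preimage b X (B : set R) :
  flip_sign b X @^-1` B = X @^-1` (if b then -%R @^-1` B else B).
Proof. by case: b. Qed.

Lemma measurable_if_opp (b : bool) (B : set R) : measurable B ->
  measurable (if b then -%R @^-1` B else B).
Proof.
case: b => // mB; rewrite -[X in measurable X]setTI.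
exact: (@oppr_measurable R setT).
Qed.

Lemma gaussian0_flip_sign b X : gaussian0 s X -> gaussian0 s (flip_sign b X).
Proof.
move=> gX A mA; rewrite /distribution /pushforward flip_sign_preimage.
rewrite -[LHS]/(distribution Pr X _) gX; last exact: measurable_if_opp.
by case: b => //; rewrite normal_prob0N.
Qed.

Lemma mutually_independent_flip_sign m (X : 'I_m -> {RV Pr >-> R}) (b : pred 'I_m) :
  mutually_independent X -> mutually_independent (fun i => flip_sign (b i) (X i)).
Proof.
move=> indX B mB; under eq_bigcapr do rewrite flip_sign_preimage.
under eq_bigr do rewrite flip_sign_preimage.
by apply: indX => i; exact: measurable_if_opp.
Qed.

Lemma gaussian0_moment2 X : gaussian0 s X ->
  (\int[Pr]_t (X t ^+ 2)%:E = \int[gauss s]_x (x ^+ 2)%:E)%E.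
Proof.
move=> gX.
have mf : measurable_fun [set: R] (fun x : R => (x ^+ 2)%:E).
  by apply/measurable_EFinP; exact: measurable_funX.
rewrite -(ge0_integral_distribution X mf)//; last first.
  by move=> x; rewrite lee_fin sqr_ge0.
by apply: eq_measure_integral => A mA _; exact: gX.
Qed.

(** The product is dominated by [X ^+ 2 + Y ^+ 2]. The case [X = Y] provides the diagonal terms of
    the variance. *)
Lemma gaussian0_integrableM X Y : gaussian0 s X -> gaussian0 s Y ->
  Pr.-integrable setT (fun t => (X t * Y t)%:E).
Proof.
move=> gX gY.
have int2 (Z : {RV Pr >-> R}) : gaussian0 s Z ->
    Pr.-integrable setT (fun t => (Z t ^+ 2)%:E).
  move=> gZ; apply/integrableP; split.
    by apply/measurable_EFinP; exact: measurable_funX.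
  under eq_integral do rewrite gee0_abs ?lee_fin ?sqr_ge0//.
  by rewrite gaussian0_moment2// gauss_moment2_lty.
apply: (le_integrable _ _ _ (integrableD _ (int2 _ gX) (int2 _ gY))) => //.
  by apply/measurable_EFinP; exact: measurable_funM.
move=> t _ /=; rewrite lee_fin [leRHS]ger0_norm ?addr_ge0 ?sqr_ge0//.
rewrite normrM -(real_normK (num_real (X t))) -(real_normK (num_real (Y t))).
set x := `|X t|; set y := `|Y t|.
by have := sqr_ge0 (x - y); have := sqr_ge0 (x + y); nra.
Qed.

Definition independent_rv X Y := forall A B : set R,
  measurable A -> measurable B ->
  Pr (X @^-1` A `&` Y @^-1` B) = (Pr (X @^-1` A) * Pr (Y @^-1` B))%E.

(** By independence the joint law agrees with the product measure on rectangles, hence everywhere;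
    the integral is therefore the same for all such pairs. *)
Lemma integral_gaussian0_pair X Y : gaussian0 s X -> gaussian0 s Y ->
  independent_rv X Y ->
  (\int[Pr]_t (X t * Y t)%:E =
   \int[(gauss s \x gauss s)%E]_z (z.1 * z.2)%:E)%E.
Proof.
move=> gX gY XY.
have mXY : measurable_fun setT (fun t => (X t, Y t)) by exact: measurable_fun_pair.
pose Z : {mfun T >-> (R * R)%type} :=
  HB.pack (fun t => (X t, Y t)) (isMeasurableFun.Build _ _ _ _ _ mXY).
transitivity (\int[distribution Pr Z]_z (z.1 * z.2)%:E)%E.
  rewrite (integral_distribution (P := Pr) (X := Z))//.
    by apply/measurable_EFinP; apply: measurable_funM.
  exact: gaussian0_integrableM.
apply: eq_measure_integral => A mA _; apply/esym.
apply: product_measure_unique => // B C mB mC.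
apply: (etrans (XY _ _ mB mC)).
by congr (_ * _)%E; [exact: gX|exact: gY].
Qed.

(* [(X, Y)] and [(X, - Y)] have the same joint law. *)
Lemma integral_gaussian0M X Y : gaussian0 s X -> gaussian0 s Y ->
  independent_rv X Y -> (\int[Pr]_t (X t * Y t)%:E = 0)%E.
Proof.
move=> gX gY XY.
have gNY := gaussian0_flip_sign true gY.
have XNY : independent_rv X (flip_sign true Y).
  move=> A B mA mB; rewrite flip_sign_preimage; apply: XY => //.
  exact: (measurable_if_opp true).
have : (\int[Pr]_t (X t * flip_sign true Y t)%:E = \int[Pr]_t (X t * Y t)%:E)%E.
  by rewrite !integral_gaussian0_pair.
under eq_integral do rewrite /= mulrN EFinN.
have intXY := gaussian0_integrableM gX gY.
rewrite integralN/=; last exact: integrable_add_def.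
have := integrable_fin_num measurableT intXY.
by case: (\int[Pr]_t _)%E => //= r _ [] /eqP; rewrite eqNr => /eqP ->.
Qed.

Lemma mutually_independent_pair m (X : 'I_m -> {RV Pr >-> R}) i j :
  mutually_independent X -> i != j -> independent_rv (X i) (X j).
Proof.
move=> indX ij A B mA mB.
(* The whole line at the other indices contributes only factors 1. *)
pose C k : set R := if k == i then A else if k == j then B else setT.
have Ci : C i = A by rewrite /C eqxx.
have Cj : C j = B by rewrite /C eq_sym (negbTE ij) eqxx.
have mC k : measurable (C k) by rewrite /C; case: eqP => // _; case: eqP.
have := indX C mC; rewrite (bigD1 i)//= (bigD1 j) ?(eq_sym j)//= Ci Cj.
rewrite big1 ?mule1 => [<-|k /andP[ki kj]]; last first.
  by rewrite /C (negbTE ki) (negbTE kj) preimage_setT probability_setT.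
congr (Pr _); apply/seteqP; split => [t [At Bt] k _|t H] /=.
  by rewrite /C; case: eqP => [->//|_]; case: eqP => [->//|].
by have := H i I; have := H j I; rewrite /= Ci Cj.
Qed.

(** Markov's inequality for the square of the sum: once it is expanded, the off-diagonal terms
    integrate to 0 and the diagonal ones give the second moment times [\sum_i a i ^+ 2]. *)
Lemma gaussian0_chebyshev m (X : 'I_m -> {RV Pr >-> R}) (a : 'I_m -> R) (eps : R) :
  mutually_independent X -> (forall i, gaussian0 s (X i)) -> 0 < eps ->
  (Pr [set t | (eps <= `|\sum_i a i * X i t|)%R] <=
   (eps ^- 2 * fine (\int[gauss s]_x (x ^+ 2)%:E) * \sum_i a i ^+ 2)%:E)%E.
Proof.
move=> indX gX e0; set M := fine _.
have Mfin : (\int[gauss s]_x (x ^+ 2)%:E)%E \is a fin_num.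
  rewrite ge0_fin_numE ?gauss_moment2_lty//.
  by apply: integral_ge0 => x _; rewrite lee_fin sqr_ge0.
pose S : {RV Pr >-> R} := \sum_i ((a i \o* X i : {mfun T >-> R})).
have SE t : S t = \sum_i a i * X i t.
  by rewrite /S mfun_sum; apply: eq_bigr => i _ /=; rewrite mulrC.
have ES2 : (\int[Pr]_t (S t ^+ 2)%:E = (M * \sum_i a i ^+ 2)%:E)%E.
  transitivity (\int[Pr]_t (\sum_i \sum_j (a i * a j)%:E * (X i t * X j t)%:E))%E.
    apply: eq_integral => t _; rewrite SE expr2 mulr_suml -sumEFin.
    apply: eq_bigr => i _; rewrite mulr_sumr -sumEFin; apply: eq_bigr => j _.
    by rewrite -EFinM mulrACA.
  have intXX i j : Pr.-integrable setT (fun t => ((a i * a j)%:E * (X i t * X j t)%:E)%E).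
    by apply: integrableZl => //; exact: gaussian0_integrableM.
  rewrite integral_sum//; last by move=> i; exact: integrable_sum.
  rewrite mulr_sumr -sumEFin; apply: eq_bigr => i _.
  rewrite integral_sum// (bigD1 i)//= big1 ?adde0 => [|j ji].
    rewrite integralZl//; last exact: gaussian0_integrableM.
    under eq_integral do rewrite -expr2.
    by rewrite gaussian0_moment2// -(fineK Mfin) -/M -EFinM -expr2 mulrC.
  rewrite integralZl//; last exact: gaussian0_integrableM.
  rewrite integral_gaussian0M ?mule0//.
  by apply: mutually_independent_pair => //; rewrite eq_sym.
have msq : measurable_fun [set: R] (fun x : R => x ^+ 2) by exact: measurable_funX.
have sq_homo : {in Num.nneg &, {homo (fun x : R => x ^+ 2) : x y / x <= y}}.
  by move=> x y; rewrite !nnegrE => x0 y0 xy; rewrite ler_pXn2r.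
have := markov S e0 msq (fun r _ => sqr_ge0 r) sq_homo.
rewrite unlock [X in (_ <= X)%E](_ : _ = (M * \sum_i a i ^+ 2)%:E); last first.
  by rewrite -ES2; apply: eq_integral => t _ /=; rewrite real_normK ?num_real.
rewrite -lee_pdivlMl ?exprn_gt0// -EFinM mulrA.
by under eq_fun do rewrite lee_fin SE.
Qed.

End gaussian_variables.

(** * Existence of finite families of independent Gaussian variables *)

Record gaussian_family (R : realType) (s : R) (m : nat) := GaussianFamily {
  gf_display : measure_display;
  gf_space : measurableType gf_display;
  gf_prob : probability gf_space R;
  gf_var : 'I_m -> {RV gf_prob >-> R};
  gf_independent : mutually_independent gf_var;
  gf_gaussian : forall i, gaussian0 s (gf_var i) }.

Definition gaussian_family0 (R : realType) (s : R) : gaussian_family s 0.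
Proof.
exists _ _ (gauss s) (fun i : 'I_0 => False_rect _ (notF (ltn_ord i))) => [B _|[]//].
rewrite big_ord0 (_ : \bigcap_(i in _) _ = setT) ?probability_setT//.
by apply/seteqP; split => // x _ [].
Qed.

(** The space is multiplied by [R] with the law [gauss s]: the second projection is the new
    variable, at index [ord0], and the old variables are shifted by [lift ord0]. *)
Definition gaussian_familyS (R : realType) (s : R) (m : nat) :
  gaussian_family s m -> gaussian_family s m.+1.
Proof.
case=> d T Pr X indX gX.
pose f (i : 'I_m.+1) (z : T * R) : R :=
  if unlift ord0 i is Some j then X j z.1 else z.2.
have mf i : measurable_fun setT (f i).
  rewrite /f; case: unliftP => [j _|_].
    by apply: measurableT_comp.
  exact: measurable_snd.
pose Q : probability (T * R)%type R := (Pr \x gauss s)%E.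
have QE A B : measurable A -> measurable B -> Q (A `*` B) = (Pr A * gauss s B)%E.
  exact: product_measure1E.
pose Y i : {RV Q >-> R} := HB.pack (f i) (isMeasurableFun.Build _ _ _ _ _ (mf i)).
have Y0 B : Y ord0 @^-1` B = setT `*` B.
  by apply/seteqP; split => -[x y]; rewrite /= /f unlift_none// => -[].
have YS j B : Y (lift ord0 j) @^-1` B = (X j @^-1` B) `*` setT.
  by apply/seteqP; split => -[x y]; rewrite /= /f liftK// => -[].
have mX j B : measurable B -> measurable (X j @^-1` B).
  by move=> mB; rewrite -[X in measurable X]setTI; exact: measurable_funP.
have QY0 B : measurable B -> Q (Y ord0 @^-1` B) = gauss s B.
  by move=> mB; rewrite Y0 QE// probability_setT mul1e.
have QYS j B : measurable B -> Q (Y (lift ord0 j) @^-1` B) = Pr (X j @^-1` B).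
  move=> mB; rewrite YS QE ?probability_setT ?mule1//; exact: mX.
exists _ _ Q Y.
- move=> B mB; rewrite big_ord_recl QY0// muleC.
  under eq_bigr do rewrite QYS//.
  (* The joint event is a rectangle: an event of the old variables times [B ord0]. *)
  rewrite -(indX (fun j => B (lift ord0 j)))// -QE//; last first.
    by apply: fin_bigcap_measurable => // j _; exact: mX.
  congr (Q _); apply/seteqP; split => [[x y] H|[x y] [/= H1 H2] i _].
    split => [j _|]; first by have := H (lift ord0 j) I; rewrite /= /f liftK.
    by have := H ord0 I; rewrite /= /f unlift_none.
  rewrite /= /f; case: unliftP => [j ->|->//]; exact: H1.
- move=> i A mA; rewrite /distribution /pushforward.
  by case: (unliftP ord0 i) => [j ->|->]; rewrite ?QY0 ?QYS//; exact: gX.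
Qed.

Lemma gaussian_family_inhabited (R : realType) (s : R) (m : nat) : gaussian_family s m.
Proof. by elim: m => [|m]; [exact: gaussian_family0|exact: gaussian_familyS]. Qed.

(** * Absence of prominent individuals and one-time wisdom *)

Section one_time_wisdom.
Variables (R : realType) (mu sigma : R) (P : forall n, 'M[R]_n.+1).
Hypotheses (sigma0 : sigma != 0) (enP : forall n, equal_neighbor (P n)).

Lemma mean_opinion_error n (x : 'I_n.+1 -> R) :
  n.+1%:R^-1 * (\sum_(i < n.+1) \sum_(j < n.+1) P n i j * (mu + x j)) - mu =
  \sum_j influence (P n) j * x j.
Proof.
have muE : mu = \sum_j influence (P n) j * mu by rewrite -mulr_suml sum_influence ?mul1r.
rewrite [X in _ - X]muE exchange_big mulr_sumr -sumrB; apply: eq_bigr => j _.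
by rewrite -mulr_suml mulrA -/(influence (P n) j) mulrDr addrAC subrr add0r.
Qed.

Lemma no_prominent_one_time_wise : no_prominent P -> one_time_wise mu sigma P.
Proof.
move=> /(no_prominent_max)[c c0 Pc] d T Pr X indX gX x1 eps eps0.
pose K := eps ^- 2 * fine (\int[gauss sigma]_x (x ^+ 2)%:E)%E.
have K0 : 0 <= K.
  rewrite mulr_ge0 ?invr_ge0 ?sqr_ge0// fine_ge0//.
  by apply: integral_ge0 => x _; rewrite lee_fin sqr_ge0.
have Kc : (K * c n)%:E @[n --> \oo] --> 0%E.
  apply: cvg_EFin; first exact: nearW.
  by rewrite -[0](mulr0 K); exact: cvgMr.
apply: squeeze_cvge (cvg_cst 0%E) Kc; apply: nearW => n.
rewrite measure_ge0/=.
under eq_fun do rewrite mean_opinion_error.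
apply: (le_trans (gaussian0_chebyshev _ _ (indX n) (gX n) eps0)) => //.
rewrite lee_fin ler_wpM2l//.
(* With [a] the influences, [\sum_j a j ^+ 2 <= c n * \sum_j a j = c n]. *)
rewrite -[leRHS]mulr1 -(sum_influence (enP n)) mulr_sumr ler_sum// => j _.
by rewrite expr2 ler_wpM2r ?influence_ge0.
Qed.

Lemma one_time_wise_no_prominent : one_time_wise mu sigma P -> no_prominent P.
Proof.
move=> wP k.
pose F n := gaussian_family_inhabited sigma n.+1.
pose X n := @gf_var _ _ _ (F n).
pose b n : pred 'I_n.+1 := predC1 (k n).
pose X' n i := flip_sign (b n i) (X n i).
have := wP _ _ _ X (fun n => gf_independent (F n)) (fun n => gf_gaussian (F n)).
have := wP _ _ _ X' (fun n => mutually_independent_flip_sign (b n) (gf_independent (F n)))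
  (fun n i => gaussian0_flip_sign sigma0 (b n i) (gf_gaussian (F n) i)).
move=> /= wX' wX; apply/cvgrPdist_lt => /= e e0.
have a0 n : 0 <= influence (P n) (k n) by exact: influence_ge0.
have := cvgeD _ (wX e e0) (wX' e e0); rewrite adde0 => /(_ _ isT) cvg_sum.
(* Eventually the error probabilities for [X] and [X'] add up to less than the fixed positive
   probability that a noise has absolute value at least 1. *)
have /cvg_sum : nbhs (0 : \bar R)%E
    [set u | (u < normal_prob 0 sigma [set x | (1 <= `|x|)%R])%E].
  exact: open_ereal_lt' (normal_prob_gt0 sigma0).
rewrite /nbhs/=/fmap/=; apply: filterS => n /=.
(* Suppose the influence of [k n] is at least [e]. Whenever the noise of [k n] has absolute value at
   least 1, one of the two errors is at least [e]; the union bound then contradicts [small]. *)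
rewrite sub0r normrN ger0_norm// => small; rewrite ltNge; apply/negP => ea.
move: small; rewrite ltNge => /negP; apply.
have mE (Y : 'I_n.+1 -> {RV gf_prob (F n) >-> R}) :
    measurable [set t | (e <= `|\sum_j influence (P n) j * Y j t|)%R].
  apply: measurable_norm_ge; apply: measurable_sum => j.
  exact: measurable_funM.
have setE (Y : 'I_n.+1 -> {RV gf_prob (F n) >-> R}) :
    [set t | (e <= `|n.+1%:R^-1 * \sum_(i < n.+1) \sum_(j < n.+1)
       P n i j * (mu + Y j t) - mu|)%R] =
    [set t | (e <= `|\sum_j influence (P n) j * Y j t|)%R].
  by under eq_fun do rewrite mean_opinion_error.
rewrite !setE.
have mA : measurable [set x : R | (1 <= `|x|)%R].
  exact: measurable_norm_ge (@measurable_id _ R setT).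
rewrite -(gf_gaussian (F n) (k n) mA).
apply: (le_trans _ (measureU2 (gf_prob (F n)) (mE (X n)) (mE (X' n)))).
rewrite /distribution /pushforward.
apply: (@le_measure _ _ _ (gf_prob (F n))); rewrite ?inE.
- exact: measurable_norm_ge.
- exact: measurableU.
move=> t /= Xk.
set S := \sum_j _; set S' := \sum_j _.
(* The noises with flipped signs cancel, and that of [k n] is counted twice. *)
have SS' : S + S' = 2 * (influence (P n) (k n) * X n (k n) t).
  rewrite /S /S' (bigD1 (k n))//= [X in _ + X](bigD1 (k n))//=.
  rewrite [X' n (k n)]/(flip_sign _ _) /b /= eqxx/= addrACA -big_split/=.
  rewrite big1 ?addr0 => [|j jk]; first by rewrite mulr_natl mulr2n.
  by rewrite /X' /b /= jk/= mulrN subrr.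
have : 2 * e <= `|S| + `|S'|.
  rewrite (le_trans _ (ler_normD _ _))// SS' normrM ger0_norm// ler_wpM2l//.
  by rewrite normrM (ger0_norm (a0 n)) (le_trans ea)// ler_peMr.
by case: (leP e `|S|) => [|Se]; [left|right; lra].
Qed.

End one_time_wisdom.

Theorem theorem6 (R : realType) (mu sigma : R) (P : forall n : nat, 'M[R]_n.+1) :
  0 < sigma ->
  (forall n, equal_neighbor (P n)) ->
  (no_prominent P <-> one_time_wise mu sigma P) /\
  (one_time_wise mu sigma P <-> pre_uniformly_wise P).
Proof.
move=> /lt0r_neq0 sigma0 enP.
have i_ii := no_prominent_one_time_wise mu sigma0 enP.
have ii_i := one_time_wise_no_prominent (mu := mu) sigma0 enP.
have i_iii := no_prominent_pre_uniformly_wise enP.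
have iii_i := pre_uniformly_wise_no_prominent enP.
by split; split => // w; [exact: i_iii (ii_i w)|exact: i_ii (iii_i w)].
Qed.
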